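(* For every integer $\kappa\ge 56$, the Potts spin glass model with $\kappa$ colors breaks color symmetry at zero temperature, i.e. $$\lim_{N\to\infty}\mathsf{GSE}^{\mathrm{bal}}_{N,\kappa}\ne\lim_{N\to\infty}\mathsf{GSE}_{N,\kappa},$$ where the first limit is taken along $N\in\kappa\mathbb N$.
   Context: For an integer $N\ge1$ write $[N]=\{1,\dots,N\}$. Let $\Sigma_\kappa=[\kappa]^N$. Let $(g_{ij})_{i,j\in[N]}$ be i.i.d. standard normal random variables. The Potts spin glass Hamiltonian is $H_N(\sigma)=\frac{1}{\sqrt N}\sum_{i,j\in[N]}g_{ij}\mathbf 1\{\sigma_i=\sigma_j\}$ for $\sigma\in\Sigma_\kappa$. The ground state energy is $\mathsf{GSE}_{N,\kappa}=\frac1N\mathbb E\max_{\sigma\in\Sigma_\kappa}H_N(\sigma)$. A configuration is balanced if $|\{i\in[N]:\sigma_i=a\}|=N/\kappa$ for every $a\in[\kappa]$; $\Sigma_\kappa^{\mathrm{bal}}$ is the set of balanced configurations, and for $N\in\kappa\mathbb N$, $\mathsf{GSE}^{\mathrm{bal}}_{N,\kappa}=\frac1N\mathbb E\max_{\sigma\in\Sigma^{\mathrm{bal}}_\kappa}H_N(\sigma)$. Both limits as $N\to\infty$ are known to exist. The model preserves color symmetry at zero temperature if $\lim_{N\to\infty}\mathsf{GSE}^{\mathrm{bal}}_{N,\kappa}=\lim_{N\to\infty}\mathsf{GSE}_{N,\kappa}$, and otherwise breaks color symmetry at zero temperature. *)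

(* Defs.v *)
From HB Require Import structures.
From mathcomp Require Import all_boot all_order all_algebra.
From mathcomp Require Import all_classical all_reals all_analysis.
Import Order.TTheory GRing.Theory Num.Theory.
Import numFieldNormedType.Exports.

Set Implicit Arguments.
Unset Strict Implicit.
Unset Printing Implicit Defensive.

Local Open Scope classical_set_scope.
Local Open Scope ring_scope.

Definition standard_normal (d : measure_display) (T : measurableType d)
    (R : realType) (P : probability T R) (X : {RV P >-> R}) : Prop :=
  forall A : set R, measurable A -> distribution P X A = normal_prob 0 1 A.

Definition mutually_independent (d : measure_display) (T : measurableType d)
    (R : realType) (P : probability T R) (I : finType)
    (X : I -> {RV P >-> R}) : Prop :=
  forall (J : {set I}) (A : I -> set R),
    (forall i, measurable (A i)) ->
    P (\bigcap_(i in [set` J]) (X i @^-1` A i)) =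
    (\prod_(i in J) P (X i @^-1` A i))%E.

Definition iid_standard_normal (d : measure_display) (T : measurableType d)
    (R : realType) (P : probability T R) (N : nat)
    (g : 'I_N -> 'I_N -> {RV P >-> R}) : Prop :=
  (forall i j, standard_normal (g i j)) /\
  mutually_independent (fun ij : 'I_N * 'I_N => g ij.1 ij.2).

Definition config (kappa N : nat) : finType := {ffun 'I_N -> 'I_kappa}.

(* Each color is used N / kappa times; the product form forces kappa %| N
   (for 0 < kappa) instead of rounding the quotient. *)
Definition balanced (kappa N : nat) : {set config kappa N} :=
  [set s : config kappa N |
    [forall a : 'I_kappa, (#|[set i : 'I_N | s i == a]| * kappa == N)%N]]%SET.

Definition hamiltonian (R : realType) (kappa N : nat) (x : 'I_N -> 'I_N -> R)
    (s : config kappa N) : R :=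
  (Num.sqrt N%:R)^-1 * \sum_(i < N) \sum_(j < N | s i == s j) x i j.

(* The supremum ranges over a finite set, so it is a maximum as soon as S is
   nonempty. *)
Definition max_energy (R : realType) (kappa N : nat) (S : {set config kappa N})
    (x : 'I_N -> 'I_N -> R) : R :=
  sup [set hamiltonian x s | s in [set` S]].

Definition ground_state_energy_on (d : measure_display) (T : measurableType d)
    (R : realType) (P : probability T R) (kappa N : nat)
    (S : {set config kappa N}) (g : 'I_N -> 'I_N -> {RV P >-> R}) : R :=
  N%:R^-1 * fine ('E_P[fun w => max_energy S (fun i j => g i j w)])%E.

(* The disorder is a separate family g N for every system size N; no joint law
   across different N is prescribed, since only expectations at fixed N occur. *)
Definition GSE (d : measure_display) (T : measurableType d) (R : realType)
    (P : probability T R) (g : forall N : nat, 'I_N -> 'I_N -> {RV P >-> R})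
    (kappa : nat) (N : nat) : R :=
  ground_state_energy_on [set: config kappa N]%SET (g N).

Definition GSE_bal (d : measure_display) (T : measurableType d) (R : realType)
    (P : probability T R) (g : forall N : nat, 'I_N -> 'I_N -> {RV P >-> R})
    (kappa : nat) (N : nat) : R :=
  ground_state_energy_on (balanced kappa N) (g N).

(* The limit N -> oo along multiples of kappa is the limit m -> oo of
   N = kappa * m. [limn] is meaningful only for convergent sequences. *)
Definition preserves_color_symmetry (d : measure_display)
    (T : measurableType d) (R : realType) (P : probability T R)
    (g : forall N : nat, 'I_N -> 'I_N -> {RV P >-> R}) (kappa : nat) : Prop :=
  limn (fun m : nat => GSE_bal g kappa (kappa * m)%N) = limn (GSE g kappa).

Definition breaks_color_symmetry (d : measure_display)
    (T : measurableType d) (R : realType) (P : probability T R)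
    (g : forall N : nat, 'I_N -> 'I_N -> {RV P >-> R}) (kappa : nat) : Prop :=
  ~ preserves_color_symmetry g kappa.

(* Main.v *)
Require Import Defs.
From HB Require Import structures.
From mathcomp Require Import all_boot all_order all_algebra.
From mathcomp Require Import all_classical all_reals all_analysis.
From mathcomp Require Import measurable_realfun.
From mathcomp Require Import ring lra.
Import Order.TTheory GRing.Theory Num.Theory.
Import numFieldNormedType.Exports.

Local Open Scope classical_set_scope.
Local Open Scope ring_scope.

(** Write k for the number of colors and q = (k - 1) / k ^ 2.

    Balanced configurations have low energy.  On them the Hamiltonian differs
    from the centred sum with coefficients (1{s_i = s_j} - 1/k) / sqrt N only
    by a multiple of the sum of all the disorder, which has mean zero and does
    not depend on the configuration.  The centred sum is Gaussian of variance
    N q, and there are at most k ^ N configurations, so the exponential-moment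
    bound on the maximum of Gaussian variables gives, for every lam > 0,
    GSE_bal <= ln k / lam + lam * q / 2 ([balanced_energy_le]).

    Two colors already do better.  If s_i = 1 or -1 records which of two
    colors the site i gets, then 1{s_i = s_j} = (1 + s_i s_j) / 2 and the
    question becomes that of the ground state of the Sherrington-Kirkpatrick
    model.  Choose the signs one at a time, giving to the site n the sign that
    makes its interaction with the sites 0, ..., n - 1 nonnegative.  The gain at
    step n is the absolute value of a centred Gaussian variable of variance 2n:
    the signs already chosen depend on the disorder in the n x n corner only,
    and the new interaction uses entries outside it ([greedy_spins]).  Its mean
    is sqrt (2 n) * sqrt (2 / pi), and summing over n < N gives
    GSE >= 2 / (3 sqrt pi) - o(1) ([ground_state_energy_ge]).

    With a = 2 / (3 sqrt pi) and lam = a / q the first bound is below a as soon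
    as q * ln k < a ^ 2 / 2 = 2 / (9 pi), which holds from k = 56 on
    ([ln_kappa_bound]); at k = 56 the margin is about 0.2 percent, so explicit
    bounds on pi and on ln 56 are needed.

    The probabilistic core is [signed_sum_law]: a signed sum of independent
    normal variables is normal, and independent of any event that, like the
    signs, is determined by the other variables. *)

(** * Gaussian measures on the line *)

Section GaussianMeasures.
Context {R : realType}.
Implicit Types (m s c : R) (B : set R).
Local Notation mu := (@lebesgue_measure R).

Lemma normal_probN m s : normal_prob m (- s) = normal_prob m s.
Proof.
apply/funext => B; apply: eq_integral => x _.
by rewrite /normal_pdf oppr_eq0 /normal_peak /normal_fun sqrrN.
Qed.

Lemma normal_pdf_affine m s x : 0 < s ->
  s * normal_pdf m s (m + s * x) = normal_pdf 0 1 x.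
Proof.
move=> s0; rewrite !normal_pdfE ?oner_eq0 ?gt_eqF// /normal_peak /normal_fun.
rewrite expr1n mul1r subr0 -mulrnAr sqrtrM ?sqr_ge0// sqrtr_sqr gtr0_norm//.
rewrite mulrA invfM mulVKf ?gt_eqF//; congr (_ * expR _).
by field; rewrite gt_eqF.
Qed.

(** The Radon-Nikodym derivative of the normal law agrees almost everywhere with
    its density, and the change of variables is known for the former. *)
Lemma ge0_integral_normal_prob m s (f : R -> \bar R) :
    (forall x, 0 <= f x)%E -> measurable_fun setT f ->
  (\int[normal_prob m s]_x f x = \int[mu]_x (f x * (normal_pdf m s x)%:E))%E.
Proof.
move=> f0 mf.
have dom := normal_prob_dominates m s.
rewrite -(Radon_Nikodym_SigmaFinite.change_of_variables dom)//.
apply: ae_eq_integral => //.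
- apply: emeasurable_funM => //; apply: (measurable_int mu).
  exact: Radon_Nikodym_SigmaFinite.f_integrable.
- apply: emeasurable_funM => //; apply/measurable_EFinP.
  exact: measurable_normal_pdf.
- apply: ae_eqe_mul2l; apply: integral_ae_eq => //.
  + exact: Radon_Nikodym_SigmaFinite.f_integrable.
  + by apply/measurable_EFinP; exact: measurable_normal_pdf.
  + by move=> E _ mE; rewrite -Radon_Nikodym_SigmaFinite.f_integral.
Qed.

Lemma lebesgue_measure_affine m s (s0 : 0 < s) (A : set R) : measurable A ->
  (s%:E * mu ((fun x : R => m + s * x)%R @^-1` A) = mu A)%E.
Proof.
have mf : measurable_fun setT ((fun x => m + s * x) : measurableTypeR R -> measurableTypeR R).
  by apply: measurable_funD => //; exact: measurable_funM.
pose f : {mfun measurableTypeR R >-> measurableTypeR R} :=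
  HB.pack (fun x => m + s * x : measurableTypeR R) (isMeasurableFun.Build _ _ _ _ _ mf).
have sE : 0 <= s by exact: ltW.
move=> mA.
apply/esym/(@lebesgue_measure_unique _
  (mscale (NngNum sE) (pushforward mu f))) => //= _ [[a b]] _ <-.
rewrite /mscale/= /pushforward.
have -> : f @^-1` `]a, b]%classic = `](a - m) / s, (b - m) / s]%classic.
  apply/seteqP; split => x /=; rewrite !in_itv/= ltr_pdivrMr// ler_pdivlMr//;
    by rewrite ltrBlDl lerBrDl mulrC.
rewrite !lebesgue_measure_itv/= !lte_fin ltr_pM2r ?invr_gt0// ltrD2r.
case: ifPn; last by rewrite mule0.
move=> _; rewrite -!EFinB -EFinM; congr EFin; field; by rewrite gt_eqF.
Qed.

(** The standard normal law is even, which reduces a negative [s] to a positive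
    one; for positive [s] this is the affine change of variables in the Lebesgue
    integral. *)
Lemma normal_prob_affine m s B : s != 0 -> measurable B ->
  normal_prob 0 1 ((fun x => m + s * x) @^-1` B) = normal_prob m s B.
Proof.
wlog s0 : s B / 0 < s => [hw s0 mB|_ mB].
  have [sn|sp|/eqP] := ltgtP s 0; [|by have := hw s B sp s0 mB|by rewrite (negbTE s0)].
  have mN : measurable_fun setT
      ((fun x => - x) : measurableTypeR R -> measurableTypeR R).
    exact: oppr_measurable.
  pose N : {mfun measurableTypeR R >-> measurableTypeR R} :=
    HB.pack (fun x => - x : measurableTypeR R) (isMeasurableFun.Build _ _ _ _ _ mN).
  have mB' : measurable ((fun x => m + (- s) * x) @^-1` B).
    have mf : measurable_fun setT (fun x : R => m + (- s) * x).
      by apply: measurable_funD => //; exact: measurable_funM.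
    by rewrite -[X in measurable X]setTI; exact: mf.
  rewrite -(normal_probN m s) -hw ?oppr_gt0 ?oppr_eq0// /normal_prob.
  transitivity (\int[pushforward mu N]_(x in (fun x => m + - s * x)%R @^-1` B)
      (normal_pdf 0 1 x)%:E)%E.
    rewrite (ge0_integral_pushforward mN)//=.
    + have -> : N @^-1` ((fun x => m + - s * x) @^-1` B) =
          (fun x => m + s * x) @^-1` B.
        by apply/funext => x; rewrite /preimage/= mulrNN.
      apply: eq_integral => x _.
      by rewrite /normal_pdf oner_eq0 /normal_fun !subr0 sqrrN.
    + by apply/measurable_EFinP/measurable_funTS; exact: measurable_normal_pdf.
    + by move=> x _; rewrite lee_fin normal_pdf_ge0.
  by apply: eq_measure_integral => //= A mA AS; exact: lebesgue_measureN.
have mf : measurable_fun setT ((fun x => m + s * x) : measurableTypeR R -> measurableTypeR R).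
  by apply: measurable_funD => //; exact: measurable_funM.
pose f : {mfun measurableTypeR R >-> measurableTypeR R} :=
  HB.pack (fun x => m + s * x : measurableTypeR R) (isMeasurableFun.Build _ _ _ _ _ mf).
have sE : 0 <= s by exact: ltW.
have mpdf D : measurable_fun D (fun x : R => (normal_pdf m s x)%:E).
  by apply/measurable_EFinP/measurable_funTS; exact: measurable_normal_pdf.
rewrite /normal_prob.
unshelve eapply (@etrans _ _
  (\int[mscale (NngNum sE) (pushforward mu f)]_(x in B) (normal_pdf m s x)%:E)%E).
- exact: mf.
- rewrite ge0_integral_mscale//=; last by move=> x _; rewrite lee_fin normal_pdf_ge0.
  rewrite (ge0_integral_pushforward mf)//=; last by move=> x _; rewrite lee_fin normal_pdf_ge0.
  rewrite -ge0_integralZl//=.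
  + by apply: eq_integral => x _; rewrite -EFinM normal_pdf_affine.
  + by rewrite -[X in measurable X]setTI; exact: (mf measurableT B mB).
  + apply/measurable_EFinP/measurable_funTS/measurableT_comp => //.
    exact: measurable_normal_pdf.
  + by move=> x _; rewrite lee_fin normal_pdf_ge0.
all: try exact: mpdf.
by apply: eq_measure_integral => //= A mA AS; exact: lebesgue_measure_affine.
Qed.

Lemma normal_prob_shift m s B : s != 0 -> measurable B ->
  normal_prob 0 s ((fun x => m + x) @^-1` B) = normal_prob m s B.
Proof.
move=> s0 mB.
have mB' : measurable ((fun x : R => m + x) @^-1` B).
  have mf : measurable_fun setT (fun x : R => m + x) by exact: measurable_funD.
  by rewrite -[X in measurable X]setTI; exact: mf.
rewrite -(normal_prob_affine 0 s _ s0 mB') -(normal_prob_affine m s B s0 mB).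
congr normal_prob.
by apply/funext => x; rewrite /preimage/= add0r.
Qed.

(** Completing the square: the joint density of (x, y), with x normal and y normal
    around x, is rewritten as the density of y times the conditional density
    of x given y. *)
Lemma normal_pdfM s c x y : 0 < s -> 0 < c ->
  let r := Num.sqrt (s ^+ 2 + c ^+ 2) in
  normal_pdf 0 s x * normal_pdf x c y =
  normal_pdf 0 r y * normal_pdf (s ^+ 2 / r ^+ 2 * y) (s * c / r) x.
Proof.
move=> s0 c0 r.
have r2 : r ^+ 2 = s ^+ 2 + c ^+ 2 by rewrite sqr_sqrtr// addr_ge0 ?sqr_ge0.
have r0 : 0 < r by rewrite sqrtr_gt0 addr_gt0// exprn_gt0.
rewrite !normal_pdfE ?gt_eqF ?divr_gt0 ?mulr_gt0// /normal_peak /normal_fun.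
rewrite mulrACA [RHS]mulrACA -!expRD; congr (_ * expR _).
  rewrite -!invfM -!sqrtrM ?mulrn_wge0 ?mulr_ge0 ?sqr_ge0 ?pi_ge0//;
    rewrite ?invr_ge0 ?mulr_ge0 ?(ltW r0) ?(ltW s0) ?(ltW c0)//.
  by congr (Num.sqrt _)^-1; field; rewrite gt_eqF.
have -> : (s * c / r) ^+ 2 = s ^+ 2 * c ^+ 2 / r ^+ 2 by rewrite !exprMn exprVn.
rewrite r2; field.
by rewrite !gt_eqF// addr_gt0// exprn_gt0.
Qed.

(** By Tonelli and [normal_pdfM], the conditional density of the first summand
    given the total integrates to 1 and leaves the density of the total. *)
Lemma normal_prob_convolution s c B : 0 < s -> 0 < c -> measurable B ->
  (normal_prob 0 s \x normal_prob 0 c)%E [set p | B (p.1 + p.2)] =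
  normal_prob 0 (Num.sqrt (s ^+ 2 + c ^+ 2)) B.
Proof.
move=> s0 c0 mB.
set r := Num.sqrt _.
have r0 : 0 < r by rewrite sqrtr_gt0 addr_gt0// exprn_gt0.
have mpdf m' s' D : measurable_fun D (fun x : R => (normal_pdf m' s' x)%:E).
  by apply/measurable_EFinP/measurable_funTS; exact: measurable_normal_pdf.
have pdf0 m' s' (x : R) : (0 <= (normal_pdf m' s' x)%:E)%E.
  by rewrite lee_fin normal_pdf_ge0.
have mD : measurable_fun setT (fun p : R * R => p.1 + p.2) by exact: measurable_funD.
have mE : measurable [set p : R * R | B (p.1 + p.2)].
  by rewrite -[X in measurable X]setTI; exact: mD.
pose f (p : R * R) := (\1_B p.2 * (normal_pdf 0 s p.1 * normal_pdf p.1 c p.2))%:E.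
have f0 p : (0 <= f p)%E.
  by rewrite lee_fin mulr_ge0// mulr_ge0 ?normal_pdf_ge0.
have mf : measurable_fun setT f.
  apply/measurable_EFinP/measurable_funM; last apply: measurable_funM.
  - by apply: measurableT_comp => //; exact: measurable_indic.
  - by apply: measurableT_comp => //; exact: measurable_normal_pdf.
  - rewrite (_ : (fun p : R * R => _) = (normal_pdf 0 c \o (fun p => p.2 - p.1))).
      by apply: measurableT_comp; [exact: measurable_normal_pdf|exact: measurable_funB].
    apply/funext => p /=.
    by rewrite !normal_pdfE ?gt_eqF// /normal_fun subr0.
transitivity (\int[mu]_x \int[mu]_y f (x, y))%E.
  rewrite /product_measure1/= ge0_integral_normal_prob//; last first.
    exact: measurable_fun_xsection.
  apply: eq_integral => x _.
  have -> : normal_prob 0 c (xsection [set p | B (p.1 + p.2)] x) = normal_prob x c B.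
    rewrite -(@normal_prob_shift x c B)// ?gt_eqF//; congr normal_prob.
    by apply/seteqP; split => y; rewrite /xsection/= ?inE.
  rewrite /normal_prob -ge0_integralZr//; last exact: mpdf.
  rewrite integral_mkcond/=; apply: eq_integral => y _.
  rewrite patchE /f/= indicE; case: (y \in B); rewrite ?mul1r ?mul0r//.
  by rewrite -EFinM mulrC.
rewrite fubini_tonelli//=.
rewrite /normal_prob [RHS]integral_mkcond/=; apply: eq_integral => y _.
rewrite /fubini_G/f/= patchE.
transitivity (\int[mu]_x ((\1_B y * normal_pdf 0 r y)%:E *
    (normal_pdf (s ^+ 2 / r ^+ 2 * y) (s * c / r) x)%:E))%E.
  by apply: eq_integral => x _; rewrite normal_pdfM// -EFinM mulrA.
rewrite ge0_integralZl//; last 2 first.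
- exact: mpdf.
- by rewrite lee_fin mulr_ge0// normal_pdf_ge0.
rewrite integral_normal_pdf mule1 indicE.
by case: (y \in B); rewrite ?mul1r ?mul0r.
Qed.

(** Completing the square turns the exponentially tilted density into a normal
    density around t * s ^ 2. *)
Lemma normal_prob_mgf s t : s != 0 ->
  (\int[normal_prob 0 s]_x (expR (t * x))%:E = (expR (t ^+ 2 * s ^+ 2 / 2))%:E)%E.
Proof.
move=> s0; rewrite ge0_integral_normal_prob//; last first.
  by apply/measurable_EFinP; apply: measurableT_comp => //; exact: measurable_funM.
transitivity (\int[mu]_x ((expR (t ^+ 2 * s ^+ 2 / 2))%:E *
    (normal_pdf (t * s ^+ 2) s x)%:E))%E.
  apply: eq_integral => x _; rewrite -!EFinM; congr EFin.
  rewrite !normal_pdfE// /normal_fun mulrCA [RHS]mulrCA -!expRD.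
  by congr (_ * expR _); field.
rewrite ge0_integralZl//; last 2 first.
- by apply/measurable_EFinP; exact: measurable_normal_pdf.
- by move=> x _; rewrite lee_fin normal_pdf_ge0.
by rewrite integral_normal_pdf mule1.
Qed.

End GaussianMeasures.

Section GaussianMoments.
Context {R : realType}.
Local Notation mu := (@lebesgue_measure R).

Lemma cvg_normal_pdfy (s : R) : 0 < s -> normal_pdf 0 s x @[x --> +oo] --> (0 : R).
Proof.
move=> s0; rewrite normal_pdfE ?gt_eqF//.
rewrite -[X in _ --> X](mulr0 (normal_peak s)); apply: cvgM; first exact: cvg_cst.
have -> : normal_fun 0 s = gauss_fun \o (fun x => x / (s * Num.sqrt 2)).
  apply/funext => x; rewrite /normal_fun /gauss_fun/= subr0; congr expR.
  by rewrite !exprMn exprVn exprMn sqr_sqrtr// mulNr mulr_natr.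
apply: cvg_comp; last exact: cvg_gauss_fun.
by apply: gt0_cvgMly; [rewrite invr_gt0 mulr_gt0// sqrtr_gt0|exact: cvg_id].
Qed.

Lemma is_derive_normal_pdf (s x : R) : s != 0 ->
  is_derive x 1 (fun y => - s ^+ 2 * normal_pdf 0 s y) (x * normal_pdf 0 s x).
Proof.
move=> s0; rewrite !normal_pdfE// /normal_fun.
apply: is_derive_eq.
rewrite /GRing.scale/= !subr0.
field.
exact: s0.
Qed.

Lemma normal_prob_abs (s : R) : 0 < s ->
  (\int[normal_prob 0 s]_x `|x|%:E = (s * Num.sqrt (2 / pi))%:E)%E.
Proof.
move=> s0; have sn0 : s != 0 by rewrite gt_eqF.
rewrite ge0_integral_normal_prob//; last by apply/measurable_EFinP.
under eq_integral do rewrite -EFinM.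
have cpdf := @continuous_normal_pdf _ 0 s sn0.
rewrite (@ge0_symfun_integralT _ (fun x => `|x| * normal_pdf 0 s x)); last 3 first.
- by move=> x; rewrite mulr_ge0// normal_pdf_ge0.
- move=> x; apply: cvgM; last exact: cpdf.
  exact: norm_continuous.
- by move=> x /=; rewrite normrN !normal_pdfE// /normal_fun !subr0 sqrrN.
rewrite -set_itvcy.
transitivity (2%:E * (\int[mu]_(x in `[0%R, +oo[) (x * normal_pdf 0 s x)%:E))%E.
  congr (_ * _)%E; apply: eq_integral => x; rewrite inE/= in_itv/= andbT => x0.
  by rewrite ger0_norm.
rewrite (@ge0_continuous_FTC2y _ _ (fun y => - s ^+ 2 * normal_pdf 0 s y) _ 0).
- rewrite -EFinB -EFinM sub0r mulNr opprK normal_pdfE// /normal_fun subr0.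
  rewrite expr0n/= oppr0 mul0r expR0 mulr1 /normal_peak; congr EFin.
  rewrite -mulrnAr sqrtrM ?sqr_ge0// sqrtr_sqr gtr0_norm//.
  rewrite -[in LHS](mulr_natl pi) sqrtrM// sqrtrM// sqrtrV ?pi_ge0//.
  have q2 : Num.sqrt 2 != 0 :> R by rewrite gt_eqF// sqrtr_gt0.
  have qp : Num.sqrt pi != 0 :> R by rewrite gt_eqF// sqrtr_gt0 pi_gt0.
  (* 2 is written as a square so that both sides are rational in sqrt 2. *)
  have e2 : 2 = Num.sqrt 2 * Num.sqrt 2 :> R by rewrite -expr2 sqr_sqrtr.
  set q := Num.sqrt 2 in q2 e2 *; rewrite e2.
  by field; rewrite sn0 q2 qp.
- by move=> x x0; rewrite mulr_ge0// normal_pdf_ge0.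
- apply: continuous_subspaceT => x; apply: cvgM; [exact: cvg_id|exact: cpdf].
- rewrite -[X in _ --> X](mulr0 (- s ^+ 2)).
  by apply: cvgM; [exact: cvg_cst|exact: cvg_normal_pdfy].
- by move=> x _; have := is_derive_normal_pdf s x sn0; case.
- apply: cvg_at_right_filter; apply: cvgM; [exact: cvg_cst|exact: cpdf].
- by move=> x _; rewrite derive1E; have [_ ->] := is_derive_normal_pdf s x sn0.
Qed.

End GaussianMoments.

(** * Independent normal variables and signed sums *)

Section IndependentGaussians.
Context {d : measure_display} {T : measurableType d} {R : realType}
  (P : probability T R) {I : finType} (X : I -> {RV P >-> R}).
Implicit Types (J : {set I}) (E : set T) (A B : set R) (i k : I).

(** A pi-system generating the sigma-algebra of the variables indexed by [J]. *)
Definition cylinders J : set (set T) :=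
  [set E | exists2 A : I -> set R, (forall i, measurable (A i)) &
    E = \bigcap_(i in [set` J]) (X i @^-1` A i)].

(** The events determined by the variables indexed by [J]. *)
Definition known J : set (set T) := <<s cylinders J >>.

Lemma measurable_preimage_RV i A : measurable A -> measurable (X i @^-1` A).
Proof. by move=> mA; rewrite -[X in measurable X]setTI; exact: measurable_funP. Qed.

Lemma cylinders_measurable J : cylinders J `<=` measurable.
Proof.
move=> _ [A mA ->]; apply: fin_bigcap_measurable; first exact: finite_finset.
by move=> i _; exact: measurable_preimage_RV.
Qed.

Lemma known_measurable J : known J `<=` measurable.
Proof.
apply: smallest_sub; first exact: sigma_algebra_measurable.
exact: cylinders_measurable.
Qed.

Lemma known_RV J i A : i \in J -> measurable A -> known J (X i @^-1` A).
Proof.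
move=> iJ mA; apply: sub_sigma_algebra.
exists (fun j => if j == i then A else setT) => [j|]; first by case: ifP.
apply/seteqP; split => t /= h; last by have := h i iJ; rewrite /= eqxx.
by move=> j /= _; case: eqP => [->|].
Qed.

Lemma known_sub J J' : J \subset J' -> known J `<=` known J'.
Proof.
move=> /fintype.subsetP JJ'; apply: smallest_sub; first exact: smallest_sigma_algebra.
move=> _ [A mA ->]; apply: sub_sigma_algebra.
exists (fun j => if j \in J then A j else setT) => [j|]; first by case: ifP.
apply/seteqP; split => t /= h j /= jJ; first by case: ifP => // ; exact: h.
by have := h j (JJ' _ jJ); rewrite /= jJ.
Qed.

Lemma known_setT J : known J setT.
Proof. exact: (@measurableT _ (g_sigma_algebraType (cylinders J))). Qed.

Lemma known_setI J E E' : known J E -> known J E' -> known J (E `&` E').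
Proof. exact: (@measurableI _ (g_sigma_algebraType (cylinders J))). Qed.

Lemma known_setU J E E' : known J E -> known J E' -> known J (E `|` E').
Proof. exact: (@measurableU _ (g_sigma_algebraType (cylinders J))). Qed.

Hypothesis Xind : mutually_independent X.

(** Both sides are finite measures in [E]; they agree on the pi-system of
    cylinders by the product rule, hence on the sigma-algebra it generates. *)
Lemma known_independent J E k A : known J E -> k \notin J -> measurable A ->
  P (E `&` X k @^-1` A) = (P E * P (X k @^-1` A))%E.
Proof.
move=> JE kJ mA; set F := X k @^-1` A.
have mF : measurable F by exact: measurable_preimage_RV.
have F0 : 0 <= fine (P F) by rewrite fine_ge0.
rewrite muleC -[P F]fineK ?fin_num_measure//.
apply: (@g_sigma_algebra_measure_unique d R T (cylinders J)
  (@cylinders_measurable J) (fun=> setT) _ _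
  (mrestr P mF) (mscale (NngNum F0) P) _ _ _ E JE).
- by move=> _; exists (fun=> setT) => //; apply/seteqP; split.
- by apply/seteqP; split => // t _; exists 0%N.
- move=> _ _ [B mB ->] [C mC ->]; exists (fun i => B i `&` C i).
    by move=> i; exact: measurableI.
  apply/seteqP; split => t /=.
    by move=> [h h'] i iJ; split; [exact: h|exact: h'].
  by move=> h; split => i iJ; have [] := h i iJ.
- move=> _ [B mB ->]; rewrite /= /mrestr /mscale/= fineK ?fin_num_measure//.
  pose C i := if i == k then A else B i.
  have mC i : measurable (C i) by rewrite /C; case: ifP.
  have CB : {in J, forall i, C i = B i}.
    by move=> i iJ; rewrite /C; case: eqP => // ik; rewrite -ik iJ in kJ.
  have -> : \bigcap_(i in [set` J]) (X i @^-1` B i) `&` F =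
            \bigcap_(i in [set` (k |: J)%SET]) (X i @^-1` C i).
    apply/seteqP; split => t /=.
      move=> [h Ft] i /=; rewrite !inE => /orP[/eqP ->|iJ].
        by rewrite /C eqxx.
      by rewrite CB//; exact: h.
    move=> h; split => [i /= iJ|]; last first.
      by have := h k; rewrite /= setU11 /C eqxx; exact.
    by have := h i; rewrite /= CB//; apply; rewrite inE iJ orbT.
  rewrite (Xind (k |: J)%SET C mC) (Xind J B mB) big_setU1//= /C eqxx; congr (_ * _)%E.
  by apply: eq_bigr => i iJ; rewrite -/(C i) CB.
- by move=> _; rewrite /= /mrestr setTI ltey_eq fin_num_measure.
Qed.

Hypothesis Xnormal : forall i, standard_normal (X i).

(** The weight [w] takes the two values c and - c, each on an event of [known J];
    on each of the two pieces [X k] is independent of the past, and c * [X k] and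
    - c * [X k] have the same law. *)
Lemma signed_RV_law J E k A (w : T -> R) (c : R) : known J E -> k \notin J ->
    measurable A -> 0 < c -> (forall t, `|w t| = c) ->
    (forall B, measurable B -> known J (w @^-1` B)) ->
  P (E `&` (fun t => w t * X k t) @^-1` A) = (P E * normal_prob 0 c A)%E /\
  known (k |: J)%SET (E `&` (fun t => w t * X k t) @^-1` A).
Proof.
move=> JE kJ mA c0 wc mw.
pose Ep := E `&` w @^-1` [set c]; pose En := E `&` w @^-1` [set - c].
have JEp : known J Ep by apply: known_setI => //; exact: mw.
have JEn : known J En by apply: known_setI => //; exact: mw.
pose S (b : R) := (fun x : R => 0 + b * x) @^-1` A.
have mS b : measurable (S b).
  have mf : measurable_fun setT (fun x : R => 0 + b * x).
    by apply: measurable_funD => //; exact: measurable_funM.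
  by rewrite -[X in measurable X]setTI; exact: mf.
have wE t : w t = c \/ w t = - c.
  by have := wc t; case: ger0P => _ <-; [left|right; rewrite opprK].
have EE : E = Ep `|` En.
  apply/seteqP; split => t /=; last by case=> [[]|[]].
  by move=> Et; case: (wE t) => wt; [left|right].
have split_ : E `&` (fun t => w t * X k t) @^-1` A =
   (Ep `&` X k @^-1` S c) `|`
   (En `&` X k @^-1` S (- c)).
  apply/seteqP; split => t; rewrite /S /= !add0r.
    by move=> [Et At]; case: (wE t) => wt; [left|right]; rewrite -wt.
  by case=> -[[Et wt] At]; split => //; rewrite wt.
have disj E1 E2 : Ep `&` E1 `&` (En `&` E2) = set0.
  apply/seteqP; split => // t /= [[[_ wp] _] [[_ wn] _]].
  have cc : c = - c by exact: etrans (esym wp) wn.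
  by move: c0; rewrite -(pmulrn_lgt0 _ (ltn0Sn 1)) mulr2n {2}cc subrr ltxx.
split.
  have -> : P (E `&` (fun t => w t * X k t) @^-1` A) =
     (P (Ep `&` X k @^-1` S c) + P (En `&` X k @^-1` S (- c)%R))%E.
    rewrite split_ measureU//.
    - by apply: measurableI; [exact: known_measurable JEp|exact: measurable_preimage_RV].
    - by apply: measurableI; [exact: known_measurable JEn|exact: measurable_preimage_RV].
  rewrite !(known_independent J)//.
  have XS b : b != 0 -> P (X k @^-1` S b) = normal_prob 0 b A.
    by move=> b0; rewrite -(normal_prob_affine 0 b A b0 mA); exact: Xnormal.
  rewrite !XS ?oppr_eq0 ?gt_eqF// normal_probN -ge0_muleDl//.
  congr (_ * _)%E; rewrite [in RHS]EE measureU//; first exact: known_measurable JEp.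
    exact: known_measurable JEn.
  by have := disj setT setT; rewrite !setIT.
rewrite split_; have JJ : J \subset (k |: J)%SET by exact: subsetU1.
have kk : k \in (k |: J)%SET by exact: setU11.
by apply: known_setU; apply: known_setI; (try exact: known_RV); exact: known_sub JJ _ _.
Qed.

(** The image of P restricted to [E] under (Y, Z), normalised by P [E], is the
    product of two normal laws because it is so on rectangles; the law of the
    sum is then their convolution.  When P [E] = 0 both sides vanish. *)
Lemma independent_sum_law E (Y Z : T -> R) (s c : R) : measurable E ->
    0 < s -> 0 < c ->
    measurable_fun setT Y -> measurable_fun setT Z ->
    (forall A B, measurable A -> measurable B ->
      P (E `&` Z @^-1` B `&` Y @^-1` A) =
      (P E * (normal_prob 0 s A * normal_prob 0 c B))%E) ->
  forall B, measurable B ->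
  P (E `&` (fun t => Z t + Y t) @^-1` B) =
  (P E * normal_prob 0 (Num.sqrt (c ^+ 2 + s ^+ 2)) B)%E.
Proof.
move=> mE s0 c0 mY mZ YZ B mB.
have mD : measurable_fun setT (fun p : measurableTypeR R * measurableTypeR R => p.1 + p.2).
  exact: measurable_funD.
have mBD : measurable [set p : measurableTypeR R * measurableTypeR R | B (p.1 + p.2)].
  by rewrite -[X in measurable X]setTI; exact: mD.
have mZY : measurable_fun setT (fun t => Z t + Y t) by exact: measurable_funD.
have mB' : measurable ((fun t => Z t + Y t) @^-1` B).
  by rewrite -[X in measurable X]setTI; exact: mZY.
have [PE0|PE0] := eqVneq (P E) 0%E.
  rewrite PE0 mul0e; apply/eqP; rewrite eq_le measure_ge0 andbT -PE0.
  by apply: le_measure; rewrite ?inE//; exact: measurableI.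
have PEgt0 : 0 < fine (P E).
  by rewrite fine_gt0// lt0e PE0 measure_ge0 ltey_eq fin_num_measure.
have PEV : 0 <= (fine (P E))^-1 by rewrite invr_ge0 ltW.
pose YZp : T -> measurableTypeR R * measurableTypeR R := fun t => (Y t, Z t).
have mYZ : measurable_fun setT YZp by exact: measurable_fun_pair.
have convE : (normal_prob 0 s \x normal_prob 0 c)%E
    [set p : measurableTypeR R * measurableTypeR R | B (p.1 + p.2)] =
    normal_prob 0 (Num.sqrt (s ^+ 2 + c ^+ 2)) B := normal_prob_convolution s c B s0 c0 mB.
rewrite [in RHS]addrC -convE.
have [Q QE] : exists Q : {measure set (measurableTypeR R * measurableTypeR R)%type -> \bar R},
    forall D, Q D = ((fine (P E))^-1%:E * P (E `&` YZp @^-1` D))%E.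
  unshelve eexists (mscale (NngNum PEV) (pushforward (mrestr P mE) YZp)); first exact: mYZ.
  by move=> A; rewrite /= /mscale /pushforward /mrestr /= setIC.
have QS := @product_measure_unique _ _ _ _ R (normal_prob 0 s) (normal_prob 0 c) Q _ _ mBD.
transitivity (P E * Q [set p | B (p.1 + p.2)%R])%E; last first.
  congr (_ * _)%E; apply/esym/QS => A B' mA mB''.
  have mulVPE x : ((fine (P E))^-1%:E * (P E * x) = x)%E.
    by rewrite muleA -[P E]fineK ?fin_num_measure// -EFinM mulVf ?gt_eqF// mul1e.
  rewrite QE -[RHS]mulVPE -YZ//; congr (_ * P _)%E.
  by apply/seteqP; split => t /=; tauto.
rewrite QE muleA -{1}[P E]fineK ?fin_num_measure// -EFinM mulfV ?gt_eqF// mul1e.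
congr (P _); congr (_ `&` _).
by apply/funext => t; rewrite /preimage/= addrC.
Qed.

(** The weights may be random, as long as they are known from the variables in [J]
    and have constant absolute values.  In the induction the event that the
    first summand lies in a set is absorbed into [E], and its index into [J]: the
    induction hypothesis then gives the joint law on rectangles that
    [independent_sum_law] asks for. *)
Lemma signed_sum_law (l : seq I) (w : I -> T -> R) (c : I -> R) J E :
    uniq l -> l != [::] -> {in l, forall i, i \notin J} ->
    {in l, forall i, 0 < c i} -> {in l, forall i t, `|w i t| = c i} ->
    {in l, forall i B, measurable B -> known J (w i @^-1` B)} ->
    known J E ->
  forall B, measurable B ->
  P (E `&` (fun t => \sum_(i <- l) w i t * X i t) @^-1` B) =
  (P E * normal_prob 0 (Num.sqrt (\sum_(i <- l) c i ^+ 2)) B)%E.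
Proof.
elim: l J E => // k l IHl J E /= /andP[kl ul] _ lJ c0 wc mw JE.
have [kJ ck0 wk mwk] : [/\ k \notin J, 0 < c k, forall t, `|w k t| = c k &
    forall B, measurable B -> known J (w k @^-1` B)].
  by split; [apply: lJ|apply: c0|apply: wc|apply: mw]; rewrite mem_head.
have [->|lN0] := eqVneq l [::].
  move=> B mB; rewrite !big_seq1 sqrtr_sqr gtr0_norm//.
  under [X in E `&` X @^-1` _]funext do rewrite big_seq1.
  by have [] := @signed_RV_law J E k B _ _ JE kJ mB ck0 wk mwk.
have lk : {subset l <= k :: l} by move=> i il; rewrite inE il orbT.
have IH E' : known (k |: J)%SET E' -> forall B, measurable B ->
    P (E' `&` (fun t => \sum_(i <- l) w i t * X i t) @^-1` B) =
    (P E' * normal_prob 0 (Num.sqrt (\sum_(i <- l) c i ^+ 2)) B)%E.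
  apply: IHl => //.
  - move=> i il; rewrite in_setU1 negb_or (lJ i (lk i il)) andbT.
    by apply: contraNneq kl => <-.
  - by move=> i il; apply: c0; exact: lk.
  - by move=> i il; apply: wc; exact: lk.
  - move=> i il B mB; apply: (known_sub J); first exact: subsetU1.
    by apply: mw => //; exact: lk.
have mwX i : i \in k :: l -> measurable_fun setT (fun t => w i t * X i t).
  move=> il; apply: measurable_funM => //.
  move=> _ B mB; rewrite setTI; apply: (@known_measurable J).
  exact: mw.
move=> B mB.
under [X in E `&` X @^-1` _]funext do rewrite big_cons.
rewrite [in RHS]big_cons -[X in _ + X]sqr_sqrtr; last first.
  by apply: sumr_ge0 => i _; exact: sqr_ge0.
apply: independent_sum_law => //.
- exact: known_measurable JE.
- rewrite sqrtr_gt0; case: l lN0 {IHl kl ul lJ wc mw IH mwX} c0 lk => // i l _ c0 lk.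
  rewrite big_cons ltr_pwDl//.
    by rewrite exprn_gt0// c0// lk// mem_head.
  by apply: sumr_ge0 => j _; exact: sqr_ge0.
- have -> : (fun t => \sum_(i <- l) w i t * X i t) =
      (fun t => \sum_(i <- l) if i \in l then w i t * X i t else 0).
    by apply/funext => t; apply: eq_big_seq => i ->.
  apply: measurable_sum => i; case: (boolP (i \in l)) => [il|_]; last exact: measurable_cst.
  by apply: mwX; exact: lk.
- by apply: mwX; rewrite mem_head.
- move=> A B' mA mB'.
  have [PE kE] := @signed_RV_law J E k B' _ _ JE kJ mB' ck0 wk mwk.
  by rewrite (IH _ kE A mA) PE -muleA (muleC (normal_prob 0 (c k) B')).
Qed.

End IndependentGaussians.

Section GaussianVariables.
Context {d : measure_display} {T : measurableType d} {R : realType}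
  (P : probability T R).
Variables (Y : T -> R) (s : R).
Hypothesis (mY : measurable_fun setT Y) (s0 : 0 < s).
Hypothesis lawY : forall B, measurable B -> P (Y @^-1` B) = normal_prob 0 s B.

Lemma ge0_integral_law (f : R -> \bar R) : measurable_fun setT f ->
  (forall x, 0 <= f x)%E -> (\int[P]_t f (Y t) = \int[normal_prob 0 s]_x f x)%E.
Proof.
move=> mf f0.
pose Y' : T -> measurableTypeR R := Y.
have mY' : measurable_fun setT Y' by [].
rewrite -[LHS]/(\int[P]_(t in Y' @^-1` setT) (f \o Y') t)%E.
rewrite -(ge0_integral_pushforward mY')//.
by apply: eq_measure_integral => A mA _; exact: lawY.
Qed.

Lemma law_abs : (\int[P]_t `|Y t|%:E = (s * Num.sqrt (2 / pi))%:E)%E.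
Proof.
rewrite -normal_prob_abs// -(ge0_integral_law (fun x => `|x|%:E))//.
by apply/measurable_EFinP.
Qed.

Lemma law_mgf u : (\int[P]_t (expR (u * Y t))%:E = (expR (u ^+ 2 * s ^+ 2 / 2))%:E)%E.
Proof.
rewrite -(@normal_prob_mgf _ s u) ?gt_eqF//.
rewrite -(ge0_integral_law (fun x => (expR (u * x))%:E))//.
by apply/measurable_EFinP; apply: measurableT_comp => //; exact: measurable_funM.
Qed.

Lemma law_integrable : P.-integrable setT (EFin \o Y).
Proof.
apply/integrableP; split; first exact/measurable_EFinP.
by under eq_integral do rewrite /= ; rewrite law_abs ltry.
Qed.

End GaussianVariables.

(** [Y] and - [Y] have the same law, so the positive and negative parts of [Y]
    have the same integral. *)
Lemma law_mean {d : measure_display} {T : measurableType d} {R : realType}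
    (P : probability T R) (Y : T -> R) (s : R) :
    measurable_fun setT Y -> 0 < s ->
    (forall B, measurable B -> P (Y @^-1` B) = normal_prob 0 s B) ->
  (\int[P]_t (Y t)%:E = 0)%E.
Proof.
move=> mY s0 lawY.
have mN : measurable_fun setT (fun t => - Y t) by exact: measurableT_comp.
have lawN B : measurable B -> P ((fun t => - Y t) @^-1` B) = normal_prob 0 s B.
  move=> mB.
  have mNB : measurable [set x | B (- x)].
    have mO : measurable_fun setT (fun x : R => - x) by exact: oppr_measurable.
    by rewrite -[X in measurable X]setTI; exact: mO.
  rewrite -[LHS]/(P (Y @^-1` [set x | B (- x)])) lawY//.
  have sn0 : s != 0 by rewrite gt_eqF.
  have sn0' : - s != 0 by rewrite oppr_eq0.
  rewrite -(normal_prob_affine 0 s _ sn0 mNB) -(normal_probN 0 s).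
  rewrite -(normal_prob_affine 0 (- s) B sn0' mB); congr normal_prob.
  by apply/funext => x; rewrite /preimage/= !add0r mulNr.
have mmax : measurable_fun setT (fun x : R => (Num.max x 0)%:E).
  by apply/measurable_EFinP; exact: measurable_maxr.
have max0 (x : R) : (0 <= (Num.max x 0)%:E)%E by rewrite lee_fin le_max lexx orbT.
rewrite integralE.
have -> : (\int[P]_t ((fun t => (Y t)%:E)^\+ t) = \int[P]_t (Num.max (Y t) 0)%:E)%E.
  by apply: eq_integral => t _; rewrite funeposE -EFin_max.
have -> : (\int[P]_t ((fun t => (Y t)%:E)^\- t) = \int[P]_t (Num.max (- Y t) 0)%:E)%E.
  by apply: eq_integral => t _; rewrite funenegE -EFin_max.
rewrite (@ge0_integral_law _ _ _ P Y s mY lawY (fun x => (Num.max x 0)%:E))//.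
rewrite (@ge0_integral_law _ _ _ P _ s mN lawN (fun x => (Num.max x 0)%:E))//.
apply: subee.
rewrite -(@ge0_integral_law _ _ _ P Y s mY lawY (fun x => (Num.max x 0)%:E))//.
rewrite ge0_fin_numE; last exact: integral_ge0.
apply: (@le_lt_trans _ _ (\int[P]_t `|Y t|%:E)%E).
  apply: ge0_le_integral => //.
  - by apply/measurable_EFinP; exact: measurable_maxr.
  - by apply/measurable_EFinP; exact: measurableT_comp.
  - by move=> t _; rewrite lee_fin ge_max ler_norm normr_ge0.
by rewrite (law_abs P Y s)// ltry.
Qed.

(** * Expectations of finite maxima *)

Section RealIntegrals.
Context {d : measure_display} {T : measurableType d} {R : realType}
  (P : probability T R).
Implicit Types f g : T -> R.

Local Notation integrable f := (P.-integrable setT (EFin \o f)).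

Lemma integrable_cstR (r : R) : integrable (fun=> r).
Proof. exact: finite_measure_integrable_cst. Qed.

Lemma integrableDR f g : integrable f -> integrable g -> integrable (fun t => f t + g t).
Proof. by move=> If Ig; exact: (integrableD measurableT If Ig). Qed.

Lemma integrableZR (r : R) f : integrable f -> integrable (fun t => r * f t).
Proof. by move=> If; exact: (integrableZl measurableT r If). Qed.

Lemma integrable_absR f : integrable f -> integrable (fun t => `|f t|).
Proof. by move=> If; exact: (integrable_abse If). Qed.

Lemma integrable_sumR (J : Type) (r : seq J) (p : pred J) (h : J -> T -> R) :
  (forall i, p i -> integrable (h i)) -> integrable (fun t => \sum_(i <- r | p i) h i t).
Proof.
move=> Ih; elim: r => [|i r IHr].
  by under [X in EFin \o X]funext do rewrite big_nil; exact: integrable_cstR.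
under [X in EFin \o X]funext do rewrite big_cons.
by case: (boolP (p i)) => [pi|_] //; apply: integrableDR => //; exact: Ih.
Qed.

Lemma integrable_domR f g : measurable_fun setT f -> (forall t, `|f t| <= g t) ->
  integrable g -> integrable f.
Proof.
move=> mf fg Ig; have mf' : measurable_fun setT (EFin \o f) by apply/measurable_EFinP.
apply: (le_integrable measurableT mf' _ Ig).
by move=> t _ /=; rewrite lee_fin (le_trans (fg t))// ler_norm.
Qed.

Lemma Rintegral_sum (J : Type) (r : seq J) (p : pred J) (h : J -> T -> R) :
  (forall i, p i -> integrable (h i)) ->
  \int[P]_t (\sum_(i <- r | p i) h i t) = \sum_(i <- r | p i) \int[P]_t h i t.
Proof.
move=> Ih; elim: r => [|i r IHr].
  under eq_Rintegral do rewrite big_nil.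
  by rewrite big_nil Rintegral_cst// mul0r.
under eq_Rintegral do rewrite big_cons.
rewrite big_cons; case: (boolP (p i)) => [pi|_] //.
by rewrite RintegralD//; [rewrite IHr|exact: Ih|exact: integrable_sumR].
Qed.

Lemma Rintegral_cstR (r : R) : \int[P]_t r = r.
Proof. by rewrite Rintegral_cst// [X in fine X](@probability_setT _ _ _ P) mulr1. Qed.

(** Instead of Jensen's inequality for the logarithm, use u <= b - 1 + exp (u - b)
    pointwise with u = lam * Z s t, and bound the one exponential by the sum over
    all [s] in [S]; the expectation of that sum is at most 1 by the choice of [b]. *)
Lemma expected_max_le (C : finType) (S : {set C}) (Z : C -> T -> R)
    (M V : T -> R) (lam v b : R) :
  0 < lam ->
  (forall s, s \in S -> measurable_fun setT (Z s)) ->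
  (forall s, s \in S -> (\int[P]_t (expR (lam * Z s t))%:E = (expR (lam ^+ 2 * v / 2))%:E)%E) ->
  integrable M -> \int[P]_t M t = 0 -> integrable V ->
  (forall t u, (forall s, s \in S -> M t + Z s t <= u) -> V t <= u) ->
  #|S|%:R * expR (lam ^+ 2 * v / 2) <= expR b ->
  \int[P]_t V t <= b / lam.
Proof.
move=> lam0 mZ Zmgf IM M0 IV VZ Sb.
pose G s t := expR (- b) * expR (lam * Z s t).
have Iexp s : s \in S -> integrable (fun t => expR (lam * Z s t)).
  move=> sS; apply/integrableP; split.
    apply/measurable_EFinP/measurableT_comp => //.
    by apply: measurable_funM => //; exact: mZ.
  under eq_integral do rewrite /= ger0_norm ?expR_ge0//.
  by rewrite Zmgf// ltry.
have IG s : s \in S -> integrable (G s) by move=> sS; apply: integrableZR; exact: Iexp.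
have EG s : s \in S -> \int[P]_t G s t = expR (- b) * expR (lam ^+ 2 * v / 2).
  move=> sS; rewrite RintegralZl//; last exact: Iexp.
  by rewrite /Rintegral Zmgf.
pose U t := (b - 1 + \sum_(s in S) G s t).
have IU : integrable U.
  by apply: integrableDR; [exact: integrable_cstR|exact: integrable_sumR].
have EU : \int[P]_t U t <= b.
  rewrite RintegralD//; [|exact: integrable_cstR|exact: integrable_sumR].
  rewrite Rintegral_cstR Rintegral_sum// (eq_bigr _ EG) sumr_const.
  rewrite -(mulr_natl (expR _ * expR _) #|S|) mulrCA.
  have : expR (- b) * (#|S|%:R * expR (lam ^+ 2 * v / 2)) <= 1.
    apply: (@le_trans _ _ (expR (- b) * expR b)).
      by rewrite ler_wpM2l// expR_ge0.
    by rewrite -expRD addNr expR0.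
  lra.
rewrite ler_pdivlMr// mulrC -RintegralZl//.
apply: (le_trans _ EU).
have IMU : integrable (fun t => lam * M t + U t).
  by apply: integrableDR => //; exact: integrableZR.
apply: (@le_trans _ _ (\int[P]_t (lam * M t + U t))).
  apply: le_Rintegral => //; first exact: integrableZR.
  move=> t _; rewrite mulrC -ler_pdivlMr//; apply: VZ => s sS.
  rewrite ler_pdivlMr// mulrDl ![_ * lam]mulrC lerD2l /U.
  rewrite (bigD1 s)//= /G -expRD.
  have := expR_ge1Dx (- b + lam * Z s t).
  have : 0 <= \sum_(i in S | i != s) expR (- b) * expR (lam * Z i t).
    by apply: sumr_ge0 => i _; rewrite mulr_ge0 ?expR_ge0.
  by rewrite /G; lra.
rewrite RintegralD//; last exact: integrableZR.
by rewrite RintegralZl// M0 mulr0 add0r.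
Qed.

End RealIntegrals.

Section MaxEnergy.
Context {R : realType} {kappa N : nat} (S : {set config kappa N}).
Implicit Types (x : 'I_N -> 'I_N -> R) (s : config kappa N).

Lemma hamiltonian_le_max_energy x s : s \in S -> hamiltonian x s <= max_energy S x.
Proof.
move=> sS; apply: ub_le_sup; last by exists s.
exists (\big[Num.max/hamiltonian x s]_(s' in S) hamiltonian x s') => _ [s' s'S <-].
exact: le_bigmax_cond.
Qed.

Lemma max_energy_le x s0 u : s0 \in S -> (forall s, s \in S -> hamiltonian x s <= u) ->
  max_energy S x <= u.
Proof.
move=> s0S Hu; apply: ge_sup; first by exists (hamiltonian x s0); exists s0.
by move=> _ [s sS <-]; exact: Hu.
Qed.

Lemma max_energyE x s0 : s0 \in S ->
  max_energy S x = \big[Num.max/hamiltonian x s0]_(s in S) hamiltonian x s.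
Proof.
move=> s0S; apply/le_anti/andP; split.
  by apply: (max_energy_le _ s0) => // s sS; exact: le_bigmax_cond.
apply: bigmax_le => [|s sS]; exact: hamiltonian_le_max_energy.
Qed.

Lemma normr_hamiltonian_le x s :
  `|hamiltonian x s| <= (Num.sqrt N%:R)^-1 * \sum_(i < N) \sum_(j < N) `|x i j|.
Proof.
rewrite normrM ger0_norm ?invr_ge0// ler_wpM2l ?invr_ge0//.
apply: (le_trans (ler_norm_sum _ _ _)); apply: ler_sum => i _.
apply: (le_trans (ler_norm_sum _ _ _)).
by rewrite big_mkcond/=; apply: ler_sum => j _; case: ifP.
Qed.

Lemma normr_max_energy_le x s0 : s0 \in S ->
  `|max_energy S x| <= (Num.sqrt N%:R)^-1 * \sum_(i < N) \sum_(j < N) `|x i j|.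
Proof.
move=> s0S; rewrite ler_norml; apply/andP; split.
  apply: le_trans (hamiltonian_le_max_energy x s0 s0S).
  by have := normr_hamiltonian_le x s0; rewrite ler_norml => /andP[].
apply: (max_energy_le _ s0) => // s _.
by have := normr_hamiltonian_le x s; rewrite ler_norml => /andP[].
Qed.

End MaxEnergy.

(** * Upper bound for balanced configurations *)

Section Energy.
Context {d : measure_display} {T : measurableType d} {R : realType}
  (P : probability T R) {kappa N : nat} (x : 'I_N -> 'I_N -> {RV P >-> R}).
Hypothesis x_iid : iid_standard_normal x.

Local Notation integrable f := (P.-integrable setT (EFin \o f)).

Lemma entry_law i j B : measurable B -> P (x i j @^-1` B) = normal_prob 0 1 B.
Proof. by have [xn _] := x_iid; exact: xn. Qed.

Lemma entry_integrable i j : integrable (x i j).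
Proof. by apply: (law_integrable P (x i j) 1) => // B mB; exact: entry_law. Qed.

Lemma entry_mean i j : \int[P]_t x i j t = 0.
Proof.
rewrite /Rintegral (@law_mean _ _ _ P (x i j) 1)// => B mB; exact: entry_law.
Qed.

Lemma measurable_hamiltonian (s : config kappa N) :
  measurable_fun setT (fun t => hamiltonian (fun i j => x i j t) s).
Proof.
apply: measurable_funM => //; apply: measurable_sum => i.
under eq_fun do rewrite big_mkcond/=.
by apply: measurable_sum => j; case: (s i == s j).
Qed.

Lemma integrable_max_energy (S : {set config kappa N}) s0 : s0 \in S ->
  integrable (fun t => max_energy S (fun i j => x i j t)).
Proof.
move=> s0S; apply: (@integrable_domR _ _ _ P _
    (fun t => (Num.sqrt N%:R)^-1 * \sum_(i < N) \sum_(j < N) `|x i j t|)).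
- under eq_fun do rewrite (max_energyE _ _ s0)//.
  elim: (index_enum _) => [|s r IHr].
    by under eq_fun do rewrite big_nil; exact: measurable_hamiltonian.
  under eq_fun do rewrite big_cons.
  case: (s \in S) => //; apply: measurable_maxr => //; exact: measurable_hamiltonian.
- by move=> t; exact: normr_max_energy_le s0S.
- apply: integrableZR; do 2 apply: integrable_sumR => ? _.
  by apply: integrable_absR; exact: entry_integrable.
Qed.

Lemma ground_state_energyE (S : {set config kappa N}) :
  ground_state_energy_on S x =
  N%:R^-1 * \int[P]_t max_energy S (fun i j => x i j t).
Proof. by rewrite /ground_state_energy_on unlock. Qed.

End Energy.

Section Balanced.
Context {kappa : nat}.

(** Identify the sites with pairs (color, rank) and keep the color. *)
Lemma balanced_nonempty m : exists s, s \in balanced kappa (kappa * m).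
Proof.
have E : (kappa * m)%N = #|{: 'I_kappa * 'I_m}| by rewrite card_prod !card_ord.
pose h (i : 'I_(kappa * m)) := enum_val (cast_ord E i).
have hb : bijective h.
  exists (fun p => cast_ord (esym E) (enum_rank p)) => i; rewrite /h.
    by rewrite enum_valK cast_ordK.
  by rewrite cast_ordKV enum_rankK.
exists [ffun i => (h i).1]; rewrite inE; apply/forallP => a.
have -> : [set i | [ffun i => (h i).1] i == a]%SET = (h @^-1: finset.setX [set a] [set: 'I_m])%SET.
  by apply/setP => i; rewrite !inE ffunE andbT.
rewrite on_card_preimset; last exact: onW_bij.
by rewrite cardsX cards1 cardsT card_ord mul1n mulnC.
Qed.

Lemma card_balanced_le N : (#|balanced kappa N| <= kappa ^ N)%N.
Proof. by rewrite (leq_trans (max_card _))// card_ffun !card_ord. Qed.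

(** In a balanced configuration the color of the site [i] is shared by exactly
    N / kappa sites. *)
Lemma balanced_row {R : realType} {N : nat} (s : config kappa N) i (a b : R) :
  (0 < kappa)%N -> s \in balanced kappa N ->
  \sum_(j < N) (if s i == s j then a else b) = N%:R * (b + (a - b) / kappa%:R).
Proof.
move=> k0; rewrite inE => /forallP /(_ (s i)) /eqP sN.
have k0R : kappa%:R != 0 :> R by rewrite pnatr_eq0 -lt0n.
have -> : \sum_(j < N) (if s i == s j then a else b) =
   \sum_(j < N) b + \sum_(j < N | s j == s i) (a - b).
  rewrite [X in _ + X]big_mkcond -big_split/=; apply: eq_bigr => j _.
  by rewrite eq_sym; case: ifP; rewrite ?addr0// addrCA subrr addr0.
set n := #|[set j | s j == s i]%SET| in sN.
have nE : #|[pred j | s j == s i]| = n by rewrite -cardsE; apply: eq_card => j; rewrite !inE.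
rewrite sumr_const card_ord sumr_const nE mulrDr -(mulr_natl b N); congr (_ + _).
by rewrite -sN natrM -(mulr_natl (a - b) n); field.
Qed.

End Balanced.

Section BalancedUpperBound.
Context {d : measure_display} {T : measurableType d} {R : realType}
  (P : probability T R) {kappa N : nat} (x : 'I_N -> 'I_N -> {RV P >-> R}).
Hypotheses (x_iid : iid_standard_normal x) (kappa_gt1 : (1 < kappa)%N) (N_gt0 : (0 < N)%N).

Let rN : R := (Num.sqrt N%:R)^-1.
Let kV : R := kappa%:R^-1.

(** The coefficient of the entry [p] once the mean 1 / kappa of the indicator
    s_i = s_j is subtracted.  The centring lowers the variance from N / kappa to
    N * (kappa - 1) / kappa ^ 2, without which the comparison fails at 56. *)
Definition centred_coef (s : config kappa N) (p : 'I_N * 'I_N) : R :=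
  (Num.sqrt N%:R)^-1 * ((s p.1 == s p.2)%:R - kappa%:R^-1).

Definition centred_energy (s : config kappa N) (t : T) : R :=
  \sum_(p : 'I_N * 'I_N) centred_coef s p * x p.1 p.2 t.

Lemma hamiltonian_centred s t :
  hamiltonian (fun i j => x i j t) s =
  rN * kV * (\sum_(p : 'I_N * 'I_N) x p.1 p.2 t) + centred_energy s t.
Proof.
rewrite /hamiltonian /centred_energy pair_big_dep/= !mulr_sumr -big_split/=.
rewrite big_mkcond/=; apply: eq_bigr => p _; rewrite /centred_coef.
by case: ifP => _ /=; rewrite /rN /kV; ring.
Qed.

Lemma centred_coef_neq0 s p : centred_coef s p != 0.
Proof.
rewrite mulf_neq0//; first by rewrite invr_eq0 gt_eqF// sqrtr_gt0 ltr0n.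
case: (s p.1 == s p.2) => /=.
  by rewrite subr_eq0 eq_sym invr_eq1 pnatr_eq1 gtn_eqF.
by rewrite sub0r oppr_eq0 invr_eq0 pnatr_eq0 -lt0n ltnW.
Qed.

Lemma sum_centred_coef_sqr s : s \in balanced kappa N ->
  \sum_(p : 'I_N * 'I_N) centred_coef s p ^+ 2 =
  N%:R * ((kappa%:R - 1) / kappa%:R ^+ 2).
Proof.
move=> sb.
have k0 : (0 < kappa)%N by exact: ltnW.
have kn0 : kappa%:R != 0 :> R by rewrite pnatr_eq0 -lt0n.
have Nn0 : N%:R != 0 :> R by rewrite pnatr_eq0 -lt0n.
rewrite -(pair_bigA _ (fun i j => centred_coef s (i, j) ^+ 2))/=.
have row i : \sum_(j < N) centred_coef s (i, j) ^+ 2 =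
    (kappa%:R - 1) / kappa%:R ^+ 2.
  transitivity (\sum_(j < N) if s i == s j then N%:R^-1 * (1 - kV) ^+ 2
     else N%:R^-1 * kV ^+ 2).
    apply: eq_bigr => j _; rewrite /centred_coef exprMn exprVn sqr_sqrtr//.
    by case: ifP => _ //=; rewrite sub0r sqrrN.
  by rewrite balanced_row// /kV; field; rewrite Nn0 kn0.
under eq_bigr do rewrite row.
by rewrite sumr_const card_ord mulr_natl.
Qed.

Lemma measurable_centred_energy s : measurable_fun setT (centred_energy s).
Proof.
by apply: measurable_sum => p; exact: measurable_funM.
Qed.

Lemma centred_energy_mgf s lam : s \in balanced kappa N ->
  (\int[P]_t (expR (lam * centred_energy s t))%:E =
   (expR (lam ^+ 2 * (N%:R * ((kappa%:R - 1) / kappa%:R ^+ 2)) / 2))%:E)%E.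
Proof.
move=> sb; have [xn xi] := x_iid.
have v0 : 0 < N%:R * ((kappa%:R - 1) / kappa%:R ^+ 2) :> R.
  by rewrite mulr_gt0 ?ltr0n// divr_gt0 ?exprn_gt0 ?ltr0n// ?subr_gt0 ?ltr1n// ltnW.
have law := @signed_sum_law _ _ _ P _ (fun p => x p.1 p.2) xi (fun p => xn p.1 p.2)
  (index_enum _) (fun p _ => centred_coef s p) (fun p => `|centred_coef s p|) finset.set0 setT
  (index_enum_uniq _).
rewrite -[in RHS](sqr_sqrtr (ltW v0)).
apply: law_mgf; first exact: measurable_centred_energy.
- by rewrite sqrtr_gt0.
have sum_sqr : \sum_(p : 'I_N * 'I_N) `|centred_coef s p| ^+ 2 =
    N%:R * ((kappa%:R - 1) / kappa%:R ^+ 2).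
  rewrite -(sum_centred_coef_sqr s)//; apply: eq_bigr => p _.
  by rewrite real_normK// num_real.
move=> B mB; rewrite -(setTI (_ @^-1` _)) law//.
- by rewrite probability_setT mul1e sum_sqr.
- by apply: contraTneq (mem_index_enum (Ordinal N_gt0, Ordinal N_gt0)) => ->.
- by move=> p _; rewrite inE.
- by move=> p _; rewrite normr_gt0 centred_coef_neq0.
- move=> p _ C mC; rewrite preimage_cst; case: ifP => _; first exact: known_setT.
  exact: (@measurable0 _ (g_sigma_algebraType _)).
- exact: known_setT.
Qed.

Lemma balanced_energy_le lam s0 : 0 < lam -> s0 \in balanced kappa N ->
  ground_state_energy_on (balanced kappa N) x <=
  ln kappa%:R / lam + lam * ((kappa%:R - 1) / kappa%:R ^+ 2) / 2.
Proof.
move=> lam0 s0b; rewrite ground_state_energyE.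
set q := (kappa%:R - 1) / _.
have N0 : 0 < N%:R :> R by rewrite ltr0n.
have k0 : 0 < kappa%:R :> R by rewrite ltr0n ltnW.
have IM : P.-integrable setT (EFin \o (fun t => rN * kV * (\sum_(p : 'I_N * 'I_N) x p.1 p.2 t))).
  by apply: integrableZR; apply: integrable_sumR => p _; exact: entry_integrable.
have := @expected_max_le _ _ _ P _ (balanced kappa N) centred_energy
  (fun t => rN * kV * (\sum_(p : 'I_N * 'I_N) x p.1 p.2 t))
  (fun t => max_energy (balanced kappa N) (fun i j => x i j t))
  lam (N%:R * q) (N%:R * ln kappa%:R + lam ^+ 2 * (N%:R * q) / 2) lam0.
move=> /(_ _ _ IM _ _ _ _) H.
rewrite mulrC ler_pdivrMr//.
apply: (le_trans (H _ _ _ _ _ _)).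
- by move=> s _; exact: measurable_centred_energy.
- by move=> s sb; exact: centred_energy_mgf.
- rewrite RintegralZl//; last by apply: integrable_sumR => p _; exact: entry_integrable.
  rewrite Rintegral_sum; last by move=> p _; exact: entry_integrable.
  by rewrite big1 ?mulr0// => p _; exact: entry_mean.
- exact: integrable_max_energy s0b.
- move=> t u Hu; apply: (max_energy_le _ _ s0) => // s sb.
  by rewrite hamiltonian_centred; exact: Hu.
- rewrite expRD ler_wpM2r ?expR_ge0// expRM_natl lnK ?posrE// -natrX ler_nat.
  exact: card_balanced_le.
- by rewrite le_eqVlt; apply/orP; left; apply/eqP; field; rewrite gt_eqF.
Qed.

End BalancedUpperBound.

(** * Greedy signs and the lower bound *)

Lemma measurable_sum_in {d : measure_display} {T : measurableType d} {R : realType}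
    (I : finType) (D : {set I}) (h : I -> T -> R) :
    (forall i, i \in D -> measurable_fun setT (h i)) ->
  measurable_fun setT (fun t => \sum_(i in D) h i t).
Proof.
move=> mh.
have -> : (fun t => \sum_(i in D) h i t) =
    (fun t => \sum_i (if i \in D then h i t else 0)).
  by apply/funext => t; rewrite big_mkcond.
apply: measurable_sum => i; case: (boolP (i \in D)) => [iD|_].
  exact: mh.
exact: measurable_cst.
Qed.

Section Greedy.
Context {d : measure_display} {T : measurableType d} {R : realType}
  (P : probability T R) {N : nat} (x : 'I_N -> 'I_N -> {RV P >-> R}).
Hypothesis x_iid : iid_standard_normal x.

Local Notation integrable f := (P.-integrable setT (EFin \o f)).
Local Notation X := (fun p : 'I_N * 'I_N => x p.1 p.2).

(** The disorder among the first [n] sites. *)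
Definition corner (n : nat) : {set 'I_N * 'I_N} :=
  [set p : 'I_N * 'I_N | (p.1 < n)%N && (p.2 < n)%N]%SET.

(** The interactions, in both directions, of the site [k] with the earlier ones. *)
Definition border (k : 'I_N) : {set 'I_N * 'I_N} :=
  [set p : 'I_N * 'I_N | (p.1 == k) && (p.2 < k)%N || (p.1 < k)%N && (p.2 == k)]%SET.

Definition spin_energy (s : 'I_N -> T -> R) (D : {set 'I_N * 'I_N}) (t : T) : R :=
  \sum_(p in D) s p.1 t * s p.2 t * x p.1 p.2 t.

Lemma ltnS_ord (k i : 'I_N) : (i < k.+1)%N = (i == k) || (i < k)%N.
Proof. by rewrite ltnS leq_eqVlt. Qed.

Lemma sum_corner_succ (k : 'I_N) (F : 'I_N * 'I_N -> R) :
  \sum_(p in corner k.+1) F p =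
  \sum_(p in corner k) F p + F (k, k) + \sum_(p in border k) F p.
Proof.
rewrite (bigID (mem (corner k)))/= -addrA; congr (_ + _).
  apply: eq_bigl => -[i j]; rewrite !inE/= !ltnS_ord.
  by case: (ltnP i k); case: (ltnP j k); rewrite ?orbT ?andbF.
rewrite (bigD1 (k, k))/=; last by rewrite !inE/= !ltnS_ord !eqxx ltnn.
congr (_ + _); apply: eq_bigl => -[i j].
rewrite !inE/= !ltnS_ord xpair_eqE.
have [->|ik] := eqVneq i k; have [->|jk] := eqVneq j k; rewrite ?ltnn ?andbF ?andbT ?orbF//=.
by case: (ltnP i k); case: (ltnP j k).
Qed.

Lemma card_ord_lt n : (n <= N)%N -> #|[set i : 'I_N | (i < n)%N]%SET| = n.
Proof.
move=> nN; rewrite -sum1_card.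
under eq_bigl do rewrite inE.
by rewrite -(big_ord_widen _ (fun=> 1%N))// sum1_card card_ord.
Qed.

Lemma card_border k : #|border k| = (k + k)%N.
Proof.
have -> : border k = (finset.setX [set k] [set i : 'I_N | (i < k)%N] :|:
                      finset.setX [set i : 'I_N | (i < k)%N] [set k])%SET.
  by apply/setP => -[i j]; rewrite !inE.
rewrite cardsU !cardsX cards1 card_ord_lt ?(ltnW (ltn_ord k))// mul1n muln1.
rewrite (_ : _ :&: _ = finset.set0)%SET ?cards0 ?subn0//.
apply/setP => -[i j]; rewrite !inE/=.
by case: eqP => [->|//]; rewrite ltnn !andbF.
Qed.

Lemma corner_disjoint_border k p : p \in border k -> p \notin corner k.
Proof.
by rewrite !inE => /orP[/andP[/eqP -> _]|/andP[_ /eqP ->]]; rewrite ltnn ?andbF.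
Qed.

Lemma corner_border_sub k : {subset border k <= corner k.+1}.
Proof.
move=> p; rewrite !inE !ltnS_ord.
by case/orP => /andP[-> ->]; rewrite ?orbT.
Qed.

Lemma spin_energy_integrable (s : 'I_N -> T -> R) D : (forall i, measurable_fun setT (s i)) ->
  (forall i t, `|s i t| = 1) -> integrable (spin_energy s D).
Proof.
move=> ms s1; apply: integrable_sumR => p _.
apply: (@integrable_domR _ _ _ P _ (fun t => `|x p.1 p.2 t|)).
- by apply: measurable_funM => //; exact: measurable_funM.
- by move=> t; rewrite !normrM !s1 !mul1r.
- by apply: integrable_absR; exact: entry_integrable.
Qed.

Definition sign_of (r : R) : R := if 0 <= r then 1 else -1.

Lemma measurable_sign_of : measurable_fun setT sign_of.
Proof.
apply: measurable_fun_ifT => //.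
exact: measurable_fun_ler.
Qed.

Lemma sign_of_norm r : `|sign_of r| = 1.
Proof. by rewrite /sign_of; case: ifP; rewrite ?normrN normr1. Qed.

Lemma sign_ofM r : sign_of r * r = `|r|.
Proof. by rewrite /sign_of; case: ger0P; rewrite ?mul1r ?mulN1r. Qed.

(** The border entries are independent of the corner that determines the signs,
    so the border energy is normal with variance the number 2k of its entries. *)
Lemma border_energy_abs (k : 'I_N) (s : 'I_N -> T -> R) :
  (forall i t, `|s i t| = 1) ->
  (forall i B, measurable B -> known P X (corner k) (s i @^-1` B)) ->
  (forall i, measurable_fun setT (s i)) ->
  \int[P]_t `|spin_energy s (border k) t| =
  Num.sqrt (k + k)%:R * Num.sqrt (2 / pi).
Proof.
move=> s1 ks ms; have [xn xi] := x_iid.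
have [k0|k0] := posnP k.
  rewrite k0 sqrtr0 mul0r -[RHS](Rintegral_cstR P 0).
  apply: eq_Rintegral => t _; rewrite /spin_energy big1 ?normr0// => p.
  by rewrite !inE k0 !ltn0 andbF.
have law := @signed_sum_law _ _ _ P _ X xi (fun p => xn p.1 p.2)
  (enum (border k)) (fun p t => s p.1 t * s p.2 t) (fun=> 1) (corner k) setT
  (enum_uniq _).
have mE : measurable_fun setT (spin_energy s (border k)).
  by apply: measurable_sum_in => p _; apply: measurable_funM => //; exact: measurable_funM.
rewrite /Rintegral (@law_abs _ _ _ P _ (Num.sqrt (k + k)%:R))//.
  by rewrite sqrtr_gt0 ltr0n addn_gt0 k0.
move=> B mB; rewrite -(setTI (_ @^-1` _)).
have -> : spin_energy s (border k) =
    (fun t => \sum_(p <- enum (border k)) s p.1 t * s p.2 t * X p t).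
  by apply/funext => t; rewrite /spin_energy big_enum.
have sum1 : \sum_(p <- enum (border k)) (1 : R) ^+ 2 = (k + k)%:R.
  by rewrite big_enum/= sumr_const card_border expr1n.
rewrite law//.
- by rewrite probability_setT mul1e sum1.
- by rewrite -size_eq0 -cardE card_border addn_eq0 negb_and -lt0n k0.
- by move=> p; rewrite mem_enum; exact: corner_disjoint_border.
- by move=> p _ t; rewrite normrM !s1 mulr1.
- move=> p _ C mC.
  have mf : measurable_fun setT (fun t : g_sigma_algebraType (cylinders P X (corner k)) =>
      s p.1 t * s p.2 t).
    by apply: measurable_funM => _ D mD; rewrite setTI; exact: ks.
  by have := mf measurableT C mC; rewrite setTI.
- exact: known_setT.
Qed.

(** When the site [n] is added, its sign is multiplied by the sign of its current
    interaction with the earlier sites, which turns this interaction into its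
    absolute value; the diagonal entry is not affected and has mean zero. *)
Lemma greedy_spins n : (n <= N)%N -> exists s : 'I_N -> T -> R,
  [/\ forall i t, `|s i t| = 1,
      forall i B, measurable B -> known P X (corner n) (s i @^-1` B) &
      \int[P]_t spin_energy s (corner n) t =
      \sum_(i < n) Num.sqrt (i + i)%:R * Num.sqrt (2 / pi)].
Proof.
elim: n => [_|n IHn nN].
  exists (fun _ _ => 1); split.
  - by move=> i t; rewrite normr1.
  - move=> i B mB; rewrite preimage_cst; case: ifP => _; first exact: known_setT.
    exact: (@measurable0 _ (g_sigma_algebraType _)).
  - rewrite big_ord0 -[RHS](Rintegral_cstR P 0).
    apply: eq_Rintegral => t _; rewrite /spin_energy big1// => p.
    by rewrite inE ltn0.
have [s [s1 ks Es]] := IHn (ltnW nN).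
pose k := Ordinal nN.
have ms i : measurable_fun setT (s i).
  move=> _ B mB; rewrite setTI; apply: (@known_measurable _ _ _ P _ X (corner n)).
  exact: ks.
pose L := spin_energy s (border k).
(* Only the spin of k changes: products of two earlier spins are unchanged, and
   the border energy is multiplied by its own sign. *)
pose s' i t := if i == k then s i t * sign_of (L t) else s i t.
have s'1 i t : `|s' i t| = 1.
  by rewrite /s'; case: ifP => // _; rewrite normrM s1 sign_of_norm mulr1.
have sub : corner n \subset corner n.+1.
  apply/fintype.subsetP => p; rewrite !inE => /andP[p1 p2].
  by rewrite !ltnS (ltnW p1) (ltnW p2).
pose T' := g_sigma_algebraType (cylinders P X (corner n.+1)).
have ks' i : measurable_fun setT (s i : T' -> R).
  move=> _ B mB; rewrite setTI; apply: (known_sub _ _ _ _ sub); exact: ks.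
have kL : measurable_fun setT (L : T' -> R).
  apply: measurable_sum_in => p pk.
  apply: measurable_funM; first exact: measurable_funM.
  move=> _ B mB; rewrite setTI; apply: (known_RV P X _ p B) => //.
  exact: (corner_border_sub k p pk).
have ks'i i : measurable_fun setT (s' i : T' -> R).
  rewrite /s'; case: (i == k) => //; apply: measurable_funM => //.
  by apply: measurableT_comp => //; exact: measurable_sign_of.
exists s'; split => //.
  by move=> i B mB; have := ks'i i measurableT B mB; rewrite setTI.
have energyE t : spin_energy s' (corner n.+1) t =
    spin_energy s (corner n) t + (x k k t + `|L t|).
  rewrite /spin_energy (sum_corner_succ k) -addrA; congr (_ + (_ + _)).
  - apply: eq_bigr => p; rewrite inE => /andP[p1 p2].
    have nk (i : 'I_N) : (i < n)%N -> (i == k) = false.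
      by move=> ik; apply/eqP => ik'; rewrite ik' ltnn in ik.
    by rewrite /s' !nk.
  - rewrite -expr2 -real_normK ?num_real// s'1 expr1n mul1r//.
  - rewrite -sign_ofM /L /spin_energy mulr_sumr; apply: eq_bigr => p.
    rewrite inE => /orP[/andP[/eqP p1 p2]|/andP[p1 /eqP p2]].
      have p2k : (p.2 == k) = false by apply/eqP => e; rewrite e ltnn in p2.
      by rewrite /s' p2k p1 eqxx; ring.
    have p1k : (p.1 == k) = false by apply/eqP => e; rewrite e ltnn in p1.
    by rewrite /s' p1k p2 eqxx; ring.
have IL : integrable L by exact: spin_energy_integrable.
have Ix : integrable (x k k) by exact: entry_integrable.
under eq_Rintegral do rewrite energyE.
rewrite RintegralD//; last 2 first.
- exact: spin_energy_integrable.
- by apply: integrableDR => //; exact: integrable_absR.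
rewrite RintegralD//; last exact: integrable_absR.
by rewrite Es entry_mean// add0r (border_energy_abs k s)// big_ord_recr.
Qed.

End Greedy.

Section LowerBound.
Context {d : measure_display} {T : measurableType d} {R : realType}
  (P : probability T R) {kappa N : nat} (x : 'I_N -> 'I_N -> {RV P >-> R}).
Hypotheses (x_iid : iid_standard_normal x) (kappa_gt1 : (1 < kappa)%N) (N_gt0 : (0 < N)%N).

(** Comparison with the integral of the square root.  With a = sqrt n and
    b = sqrt (n + 1) the step is (b - a) ^ 2 * (b + 2 a) >= 0. *)
Lemma sum_sqrt_ge n :
  2 / 3 * (n%:R * Num.sqrt n%:R) - Num.sqrt n%:R <= \sum_(i < n) Num.sqrt i%:R :> R.
Proof.
elim: n => [|n IHn]; first by rewrite big_ord0 sqrtr0 mulr0 mulr0 subr0.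
rewrite big_ord_recr/=.
set a := Num.sqrt n%:R in IHn *; set b := Num.sqrt n.+1%:R.
have aE : n%:R = a ^+ 2 by rewrite sqr_sqrtr.
have bE : n.+1%:R = b ^+ 2 by rewrite sqr_sqrtr.
have a0 : 0 <= a by exact: sqrtr_ge0.
have b0 : 0 <= b by exact: sqrtr_ge0.
have ab : b ^+ 2 = a ^+ 2 + 1 by rewrite -aE -bE -natr1.
rewrite bE; rewrite aE in IHn.
have : 0 <= (b - a) ^+ 2 * (b + 2 * a) by rewrite mulr_ge0 ?sqr_ge0// addr_ge0// mulr_ge0.
nra.
Qed.

(** A configuration using two colors according to greedy signs has energy
    (sum of all entries + spin energy) / (2 sqrt N), whose first part has mean
    zero. *)
Lemma ground_state_energy_ge :
  2 / (3 * Num.sqrt pi) - (N%:R * Num.sqrt pi)^-1 <=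
  ground_state_energy_on [set: config kappa N]%SET x.
Proof.
rewrite ground_state_energyE.
have [s [s1 ks Es]] := greedy_spins P x x_iid N (leqnn N).
have ms i : measurable_fun setT (s i).
  move=> _ B mB; rewrite setTI.
  exact: (known_measurable P (fun p : 'I_N * 'I_N => x p.1 p.2) (corner N)) (ks i B mB).
pose c0 : 'I_kappa := Ordinal (ltnW kappa_gt1).
pose c1 : 'I_kappa := Ordinal kappa_gt1.
pose two_colors t : config kappa N := [ffun i => if s i t == 1 then c0 else c1].
pose rN : R := (Num.sqrt N%:R)^-1.
pose H t : R :=
  rN / 2 * (\sum_(p : 'I_N * 'I_N) x p.1 p.2 t + spin_energy P x s (corner N) t).
have HE t : hamiltonian (fun i j => x i j t) (two_colors t) =
    H t.
  rewrite /H /hamiltonian pair_big_dep/= -mulrA; congr (_ * _).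
  have -> : spin_energy P x s (corner N) t =
      \sum_(p : 'I_N * 'I_N) s p.1 t * s p.2 t * x p.1 p.2 t.
    by apply: eq_bigl => p; rewrite inE !ltn_ord.
  rewrite -big_split/= mulr_sumr big_mkcond/=; apply: eq_bigr => p _.
  have sE i : s i t = 1 \/ s i t = -1.
    by have := s1 i t; case: ger0P => _ <-; [left|right; rewrite opprK].
  have n11 : (-1 == 1 :> R) = false by apply/negbTE; rewrite lt_eqF//; lra.
  rewrite !ffunE; case: (sE p.1) => ->; case: (sE p.2) => ->; rewrite ?eqxx ?n11 /=; lra.
have Isum : P.-integrable setT (EFin \o (fun t => \sum_(p : 'I_N * 'I_N) x p.1 p.2 t)).
  by apply: integrable_sumR => p _; exact: entry_integrable.
have IQ : P.-integrable setT (EFin \o spin_energy P x s (corner N)).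
  exact: spin_energy_integrable.
have ID := integrableDR P _ _ Isum IQ.
have le_max : \int[P]_t H t <= \int[P]_t max_energy [set: config kappa N]%SET (fun i j => x i j t).
  apply: le_Rintegral => //; first exact: integrableZR.
    exact: (integrable_max_energy P x x_iid _ [ffun=> c0]).
  by move=> t _; rewrite -HE; exact: hamiltonian_le_max_energy.
have N0 : 0 < N%:R :> R by rewrite ltr0n.
apply: (@le_trans _ _ (N%:R^-1 * \int[P]_t H t)); last first.
  by rewrite ler_wpM2l// invr_ge0 ltW.
rewrite /H RintegralZl// RintegralD// Es Rintegral_sum; last first.
  by move=> p _; exact: entry_integrable.
rewrite big1 => [|p _]; last exact: entry_mean.
rewrite add0r.
have termE (i : 'I_N) : Num.sqrt (i + i)%:R * Num.sqrt (2 / pi) =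
    2 / Num.sqrt pi * Num.sqrt i%:R :> R.
  rewrite addnn -muln2 natrM sqrtrM// sqrtrM// sqrtrV ?pi_ge0//.
  have e2 : 2 = Num.sqrt 2 * Num.sqrt 2 :> R by rewrite -expr2 sqr_sqrtr.
  by rewrite [X in _ = X / _ * _]e2; ring.
under eq_bigr do rewrite termE.
rewrite -mulr_sumr.
have sp0 : 0 < Num.sqrt pi :> R by rewrite sqrtr_gt0 pi_gt0.
have sN0 : 0 < Num.sqrt N%:R :> R by rewrite sqrtr_gt0.
apply: (@le_trans _ _ (N%:R^-1 * (rN / 2 * (2 / Num.sqrt pi *
   (2 / 3 * (N%:R * Num.sqrt N%:R) - Num.sqrt N%:R))))).
  by rewrite le_eqVlt; apply/orP; left; apply/eqP; rewrite /rN; field; rewrite !gt_eqF.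
apply: ler_wpM2l; first by rewrite invr_ge0 ltW.
apply: ler_wpM2l; first by rewrite divr_ge0// invr_ge0 ltW.
apply: ler_wpM2l; first by rewrite divr_ge0// ltW.
exact: sum_sqrt_ge.
Qed.

End LowerBound.

(** * Numerical comparison *)

Section Numerics.
Context {R : realType}.
Implicit Types x : R.

Lemma sin_le_id x : 0 <= x -> sin x <= x.
Proof.
move=> x0; rewrite -subr_ge0.
have := @ger0_derive1_ndecry R (fun y => y - sin y) 0.
move=> /(_ _ _ _ 0 x (lexx 0) x0); rewrite sin0 subr0; apply.
- by move=> y _.
- move=> y _; rewrite derive1E deriveB// derive_id derive_val subr_ge0.
  exact: cos_le1.
- apply: continuous_subspaceT => y.
  by apply: cvgB; [exact: cvg_id|exact: continuous_sin].
Qed.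

Lemma cos_ge_quadratic x : 0 <= x -> 1 - x ^+ 2 / 2 <= cos x.
Proof.
move=> x0; rewrite -subr_ge0.
have := @ger0_derive1_ndecry R (fun y => cos y - (1 - y ^+ 2 / 2)) 0.
move=> /(_ _ _ _ 0 x (lexx 0) x0).
rewrite cos0 expr0n/= mul0r subr0 subrr; apply.
- by move=> y _.
- move=> y; rewrite in_itv/= andbT => /ltW y0.
  rewrite derive1E derive_val /GRing.scale/=.
  have := sin_le_id _ y0; lra.
- apply: continuous_subspaceT => y.
  apply: cvgB; first exact: continuous_cos.
  apply: cvgB; first exact: cvg_cst.
  by apply: cvgM; [exact: sqr_continuous|exact: cvg_cst].
Qed.

Lemma sin_ge_cubic x : 0 <= x -> x - x ^+ 3 / 6 <= sin x.
Proof.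
move=> x0; rewrite -subr_ge0.
have := @ger0_derive1_ndecry R (fun y => sin y - (y - y ^+ 3 / 6)) 0.
move=> /(_ _ _ _ 0 x (lexx 0) x0).
rewrite sin0 expr0n/= mul0r !subr0; apply.
- by move=> y _.
- move=> y; rewrite in_itv/= andbT => /ltW y0.
  rewrite derive1E derive_val /GRing.scale/=.
  have := cos_ge_quadratic _ y0; lra.
- apply: continuous_subspaceT => y.
  apply: cvgB; first exact: continuous_sin.
  apply: cvgB; first exact: cvg_id.
  by apply: cvgM; [exact: exprn_continuous|exact: cvg_cst].
Qed.

(** Since sin (pi / 2) = 1, u = sin (pi / 6) is a root of
    1 - (3 u - 4 u ^ 3) = (u + 1) (2 u - 1) ^ 2. *)
Lemma sin_pi6 : sin (pi / 6 : R) = 1 / 2.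
Proof.
set a := pi / 6; have aE : pi / 2 = a *+ 2 + a by rewrite /a; field.
have : sin (a *+ 2 + a) = 1 by rewrite -aE sin_pihalf.
rewrite sinD sin_mulr2n cos_mulr2n => e.
have p0 := @pi_gt0 R.
have s0 : 0 < sin a by apply: sin_gt0_pi; rewrite /a; apply/andP; split; lra.
have c2 := cos2sin2 a.
have {}e : 3 * sin a - 4 * sin a ^+ 3 = 1.
  apply: etrans e.
  have -> : (cos a * sin a) *+ 2 * cos a + (cos a ^+ 2 *+ 2 - 1) * sin a =
     4 * sin a * cos a ^+ 2 - sin a by ring.
  by rewrite c2; ring.
have {}e : (sin a + 1) * (2 * sin a - 1) ^+ 2 = 0.
  have -> : (sin a + 1) * (2 * sin a - 1) ^+ 2 = 1 -
     (3 * sin a - 4 * sin a ^+ 3) by ring.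
  by rewrite e subrr.
move: (sin a) e s0 => u e u0.
have un0 : u + 1 != 0 by rewrite gt_eqF// addr_gt0.
have /eqP := e; rewrite mulf_eq0 (negbTE un0) sqrf_eq0/= => /eqP h; lra.
Qed.

(** If pi / 6 were at least 54 / 103, monotonicity of the sine would contradict
    sin x >= x - x ^ 3 / 6, whose value at 54 / 103 already exceeds 1 / 2. *)
Lemma pi_lt : pi < 324 / 103 :> R.
Proof.
rewrite ltNge; apply/negP => pi_ge.
have := sin_ge_cubic (54 / 103).
move=> /(_ ltac:(lra)) h.
have : sin (54 / 103) <= sin (pi / 6 : R).
  have p0 := @pi_gt0 R.
  have : 54 / 103 <= pi / 6 :> R by lra.
  rewrite le_eqVlt => /orP[/eqP -> //|lt].
  by apply: ltW; rewrite ltr_sin// in_itv/=; apply/andP; split; lra.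
rewrite sin_pi6; lra.
Qed.

Lemma expR_ge_sum x n : 0 <= x -> \sum_(0 <= i < n) x ^+ i / i`!%:R <= expR x.
Proof.
move=> x0; apply: (nondecreasing_cvgn_le _ (is_cvg_series_exp_coeff x) n).
by apply/nondecreasing_series => i _ _; exact: exp_coeff_ge0.
Qed.

(** Five terms of the exponential series at 72 / 143, raised to the power 8. *)
Lemma ln56_le : ln (56 : R) <= 576 / 143.
Proof.
rewrite -ler_expR lnK ?posrE//.
have -> : 576 / 143 = 8%:R * (72 / 143) :> R by field.
rewrite expRM_natl.
have := expR_ge_sum (72 / 143) 5 ltac:(lra).
rewrite !big_nat_recr//= big_nil !factS fact0 => h.
have {}h : 827 / 500 <= expR (72 / 143 : R).
  by apply: le_trans h; lra.
apply: (@le_trans _ _ ((827 / 500) ^+ 8)); first lra.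
rewrite ler_pXn2r// nnegrE; [lra|exact: expR_ge0].
Qed.

(** The logarithm is bounded by its tangent line at 56, up to the error in ln 56;
    the inequality becomes quadratic in [kappa].  With 324 / 103 for pi and
    576 / 143 for ln 56 it still holds at 56, barely. *)
Lemma ln_kappa_bound (kappa : nat) : (56 <= kappa)%N ->
  (kappa%:R - 1) / kappa%:R ^+ 2 * ln kappa%:R < (2 / (3 * Num.sqrt pi)) ^+ 2 / 2 :> R.
Proof.
move=> k56; set k := kappa%:R.
have k56R : 56 <= k by rewrite ler_nat.
have k0 : 0 < k by lra.
have lnk : ln k <= 576 / 143 + (k / 56 - 1).
  have -> : k = 56 * (1 + (k / 56 - 1)) by field.
  rewrite lnM ?posrE//; last lra.
  apply: lerD; first exact: ln56_le.
  have -> : 56 * (1 + (k / 56 - 1)) / 56 - 1 = k / 56 - 1 by field.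
  by apply: le_ln1Dx; lra.
have p0 := @pi_gt0 R.
have sqr_peak (p : R) : 0 < p -> (2 / (3 * Num.sqrt p)) ^+ 2 / 2 = 2 / (9 * p).
  move=> p_gt0; rewrite exprMn exprVn exprMn sqr_sqrtr ?ltW//; field.
  by rewrite gt_eqF.
rewrite sqr_peak//.
apply: (@lt_trans _ _ (103 / 1458)); last first.
  by rewrite ltr_pdivlMr ?mulr_gt0//; have := pi_lt; lra.
rewrite mulrAC ltr_pdivrMr ?exprn_gt0//.
apply: (@le_lt_trans _ _ ((k - 1) * (576 / 143 + (k / 56 - 1)))).
  by rewrite ler_wpM2l// subr_ge0; lra.
have : 0 <= (k - 56) * (k - 56) by rewrite mulr_ge0// subr_ge0.
rewrite -subr_gt0; lra.
Qed.

End Numerics.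

(** * Breaking of color symmetry *)

Theorem mainTheorem3 (R : realType) (d : measure_display)
    (T : measurableType d) (P : probability T R)
    (g : forall N : nat, 'I_N -> 'I_N -> {RV P >-> R})
    (g_iid : forall N : nat, iid_standard_normal (g N))
    (kappa : nat) (kappa_ge56 : (56 <= kappa)%N)
    (GSE_cvg : cvgn (GSE g kappa))
    (GSE_bal_cvg : cvgn (fun m : nat => GSE_bal g kappa (kappa * m)%N)) :
  breaks_color_symmetry g kappa.
Proof.
have k1 : (1 < kappa)%N by exact: leq_trans kappa_ge56.
have kR1 : 1 < kappa%:R :> R by rewrite ltr1n.
set a : R := 2 / (3 * Num.sqrt pi).
set q : R := (kappa%:R - 1) / kappa%:R ^+ 2.
have sp0 : 0 < Num.sqrt pi :> R by rewrite sqrtr_gt0 pi_gt0.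
have a0 : 0 < a by rewrite divr_gt0// mulr_gt0.
have q0 : 0 < q by rewrite divr_gt0 ?subr_gt0// exprn_gt0// (lt_trans ltr01).
(* The bound of [balanced_energy_le] at lam = a / q. *)
pose u := ln kappa%:R / (a / q) + a / q * q / 2.
have ua : u < a.
  have uE : u = (q * ln kappa%:R) / a + a / 2.
    by rewrite /u; field; rewrite !gt_eqF.
  have := @ln_kappa_bound R kappa kappa_ge56; rewrite -/a -/q => qa.
  have : q * ln kappa%:R / a < a / 2.
    rewrite ltr_pdivrMr//; apply: lt_le_trans qa _.
    by rewrite expr2 mulrAC.
  rewrite uE; lra.
have bal_le : limn (fun m => GSE_bal g kappa (kappa * m)%N) <= u.
  apply: limr_le => //; near=> m.
  have m0 : (0 < m)%N by near: m; exact: nbhs_infty_gt.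
  have [s0 s0b] := @balanced_nonempty kappa m.
  apply: (@balanced_energy_le _ _ _ P kappa _ (g _) (g_iid _) k1 _ _ s0) => //.
    by rewrite muln_gt0 m0 ltnW.
  by rewrite divr_gt0.
have gse_ge : (u + a) / 2 <= limn (GSE g kappa).
  apply: limr_ge => //; near=> N.
  have NR : ((a - u) / 2 * Num.sqrt pi)^-1 <= N%:R.
    by near: N; exact: nbhs_infty_ger.
  have d0 : 0 < (a - u) / 2 * Num.sqrt pi by rewrite mulr_gt0// divr_gt0// subr_gt0.
  have N0 : 0 < N%:R :> R by apply: lt_le_trans NR; rewrite invr_gt0.
  have N0' : (0 < N)%N by rewrite -(ltr0n R).
  apply: le_trans (ground_state_energy_ge P (g N) (g_iid N) k1 N0').
  rewrite -/a.
  have : (N%:R * Num.sqrt pi)^-1 <= (a - u) / 2.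
    rewrite -[leRHS]invrK lef_pV2 ?posrE ?invr_gt0 ?mulr_gt0//.
    - by rewrite -ler_pdivrMr// -invfM.
    - by rewrite subr_gt0.
  lra.
rewrite /breaks_color_symmetry /preserves_color_symmetry => lim_eq.
rewrite lim_eq in bal_le; lra.
Unshelve. all: by end_near.
Qed.
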